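(* Let $k$ be a field, $n\ge1$, $b>0$ and $a>2b$ integers, and let $p$, the ring $S$, the Sylvester forms, their ordering, the ideals $\mathcal H(i_1,\ldots,i_j)$ and the monomial order be as specified in the context. Let $2\le j\le p-1$, let $1\le i_1<\cdots<i_j\le n$, and let $H_{j'}^{k_1,\ldots,k_{j'}}$ be the first Sylvester form succeeding $H_j^{i_1,\ldots,i_j}$ in the ordering. Then $$\mathcal H(i_1,\ldots,i_j):H_{j'}^{k_1,\ldots,k_{j'}}={\rm in}(\mathcal H(i_1,\ldots,i_j)):{\rm in}(H_{j'}^{k_1,\ldots,k_{j'}}).$$ In particular, the colon ideal on the left hand side is a monomial ideal.
   Context: $R=k[x_1,\ldots,x_n]$, $S=R[y_1,\ldots,y_n,w]$. If $a\le nb$, $p$ is the unique integer with $1\le p\le n$ and $(p-1)b<a\le pb$; if $a>nb$, $p=n$. (So $p-1$ is the reduction number of the ideal $I=(x_1^a,\ldots,x_n^a,(x_1\cdots x_n)^b)$.) For $\{i_1,\ldots,i_j\}\subset\{1,\ldots,n\}$, $P(i_1,\ldots,i_j)$ is the product of the variables in $\{x_1,\ldots,x_n\}\setminus\{x_{i_1},\ldots,x_{i_j}\}$. Let $K_{i,l}=x_i^ay_l-x_l^ay_i$ ($1\le i<l\le n$), $L_i=x_i^{a-b}w-P(i)^by_i$ ($1\le i\le n$), and let $\mathcal L\subset S$ be the ideal generated by all $K_{i,l}$ and $L_i$. Sylvester forms: for $2\le j\le p-1$ and $1\le i_1<\cdots<i_j\le n$, $$H_j^{i_1,\ldots,i_j}=(x_{i_1}\cdots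 x_{i_j})^{a-jb}w^j-P(i_1,\ldots,i_j)^{jb}y_{i_1}\cdots y_{i_j};$$ in degree $p$ there is the single form $H_p^{1,\ldots,p}$, equal to $w^p-P(1,\ldots,p)^{pb}(x_1\cdots x_p)^{pb-a}y_1\cdots y_p$ if $a\le nb$, and to $(x_1\cdots x_n)^{a-nb}w^n-y_1\cdots y_n$ if $a>nb$ (where $p=n$). Ordering of the forms: forms of smaller degree $j$ come first; among forms of the same degree $j$, $H_j^{i_1,\ldots,i_j}$ comes before $H_j^{k_1,\ldots,k_j}$ if $i_t<k_t$ for the first index $t$ with $i_t\ne k_t$. The first form is $H_2^{1,2}$ and the last is $H_p^{1,\ldots,p}$. The ideal $\mathcal H(i_1,\ldots,i_j)=(\mathcal L,H_2^{1,2},\ldots,H_j^{i_1,\ldots,i_j})\subset S$ is generated by $\mathcal L$ together with all Sylvester forms up to and including $H_j^{i_1,\ldots,i_j}$ in this ordering. Initial terms and initial ideals ${\rm in}(\cdot)$ are with respect to the lexicographic order on $S$ with $w>x_n>\cdots>x_1$ and every $x_i$ larger than every $y_l$. *)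

(* Defs.v *)
From HB Require Import structures.
From mathcomp Require Import all_boot all_order all_algebra all_fingroup.
From mathcomp Require Export mpoly.

Set Implicit Arguments.
Unset Strict Implicit.
Unset Printing Implicit Defensive.

Import Order.TTheory GRing.Theory.
Local Open Scope ring_scope.

(* Ideals are Prop-valued predicates: membership in an ideal of a polynomial
   ring over an arbitrary field is not given by a boolean test. *)
Section Ideals.
Variable A : comNzRingType.
Implicit Types (I G : A -> Prop) (f g : A).

Definition ideal_gen G f : Prop :=
  exists (m : nat) (c g : 'I_m -> A),
    (forall i, G (g i)) /\ f = \sum_(i < m) c i * g i.

Definition colon I f : A -> Prop := fun g => I (g * f).

End Ideals.

Definition monomial_ideal (N : nat) (k : fieldType)
    (I : {mpoly k[N]} -> Prop) : Prop :=
  exists M : 'X_{1..N} -> Prop,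
    forall f, I f <-> ideal_gen (fun g => exists2 m, M m & g = 'X_[m]) f.

(* S = k[w, x_1..x_n, y_1..y_n] has 1 + (n + n) variables.  Indices are shifted
   by one: the ordinal i : 'I_n stands for i + 1. *)
Section Variables.
Variable n : nat.

Definition w_idx : 'I_(1 + (n + n)) := lshift (n + n) ord0.
Definition x_idx (i : 'I_n) : 'I_(1 + (n + n)) := rshift 1 (lshift n i).
Definition y_idx (i : 'I_n) : 'I_(1 + (n + n)) := rshift 1 (rshift n i).

(* The variables in decreasing order w > x_n > ... > x_1 > y's.  The relative
   order of the y's is arbitrary, given by the permutation s. *)
Definition var_seq (s : 'S_n) : seq 'I_(1 + (n + n)) :=
  w_idx :: [seq x_idx i | i <- rev (enum 'I_n)]
        ++ [seq y_idx (s i) | i <- enum 'I_n].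

Definition lex_key (s : 'S_n) (m : 'X_{1..1 + (n + n)}) : seqlexi nat :=
  [seq m v | v <- var_seq s].

Definition lex_le (s : 'S_n) (m m' : 'X_{1..1 + (n + n)}) : bool :=
  (lex_key s m <= lex_key s m')%O.

End Variables.

Section Initial.
Variables (n : nat) (k : fieldType) (s : 'S_n).
Implicit Type f : {mpoly k[1 + (n + n)]}.

(* The lex_le-largest monomial of the support; 0%MM if f = 0. *)
Definition in_monom f : 'X_{1..1 + (n + n)} :=
  head 0%MM [seq m <- msupp f | all (fun m' => lex_le s m' m) (msupp f)].

(* in(f), with its coefficient; in(0) = 0. *)
Definition in_term f : {mpoly k[1 + (n + n)]} :=
  f@_(in_monom f) *: 'X_[in_monom f].

Definition in_ideal (I : {mpoly k[1 + (n + n)]} -> Prop) :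
    {mpoly k[1 + (n + n)]} -> Prop :=
  ideal_gen (fun g => exists2 f, I f & g = in_term f).

End Initial.

Definition is_sylvester_degree (n a b p : nat) : bool :=
  if (a <= n * b)%N then (1 <= p <= n)%N && (p.-1 * b < a <= p * b)%N
  else p == n.

(* A subset {i_1 < ... < i_j} is a C : {set 'I_n} with #|C| = j; it indexes a
   Sylvester form when 2 <= j <= p - 1, or when it is {1, ..., p}. *)
Definition sylvester_index (n p : nat) (C : {set 'I_n}) : bool :=
  (2 <= #|C|)%N && ((#|C| < p)%N || (C == [set i : 'I_n | (i < p)%N])).

(* enum C lists C in increasing order, so this is [:: i_1; ...; i_j]. *)
Definition index_seq (n : nat) (C : {set 'I_n}) : seq nat :=
  [seq val i | i <- enum C].

Definition form_lt (n : nat) (C D : {set 'I_n}) : Prop :=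
  (#|C| < #|D|)%N \/
  (#|C| = #|D| /\
   exists2 t, (t < #|C|)%N &
     (forall r, (r < t)%N ->
        nth 0%N (index_seq C) r = nth 0%N (index_seq D) r) /\
     (nth 0%N (index_seq C) t < nth 0%N (index_seq D) t)%N).

Definition form_succ (n p : nat) (C D : {set 'I_n}) : Prop :=
  [/\ sylvester_index p D, form_lt C D &
      forall E : {set 'I_n}, sylvester_index p E -> form_lt C E ->
        E = D \/ form_lt D E].

Section Forms.
Variables (k : fieldType) (n a b p : nat).
Local Notation S := {mpoly k[1 + (n + n)]}.

Definition Xw : S := 'X_(w_idx n).
Definition Xx (i : 'I_n) : S := 'X_(x_idx i).
Definition Xy (i : 'I_n) : S := 'X_(y_idx i).

Definition prodx (C : {set 'I_n}) : S := \prod_(i in C) Xx i.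
Definition prody (C : {set 'I_n}) : S := \prod_(i in C) Xy i.

(* P(i_1, ..., i_j) *)
Definition coprodx (C : {set 'I_n}) : S := prodx (~: C).

Definition formK (i l : 'I_n) : S := Xx i ^+ a * Xy l - Xx l ^+ a * Xy i.

Definition formL (i : 'I_n) : S :=
  Xx i ^+ (a - b) * Xw - coprodx [set i] ^+ b * Xy i.

Definition idealL : S -> Prop :=
  ideal_gen (fun g =>
    (exists i l : 'I_n, (i < l)%N /\ g = formK i l) \/
    (exists i : 'I_n, g = formL i)).

(* On the indices where this is used, every truncated subtraction of exponents
   is a genuine one. *)
Definition formH (C : {set 'I_n}) : S :=
  if (#|C| < p)%N then
    prodx C ^+ (a - #|C| * b) * Xw ^+ #|C|
    - coprodx C ^+ (#|C| * b) * prody C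
  else if (a <= n * b)%N then
    Xw ^+ p - coprodx C ^+ (p * b) * prodx C ^+ (p * b - a) * prody C
  else
    prodx [set: 'I_n] ^+ (a - n * b) * Xw ^+ n - prody [set: 'I_n].

Definition idealH (C : {set 'I_n}) : S -> Prop :=
  ideal_gen (fun g =>
    idealL g \/
    exists D : {set 'I_n},
      [/\ sylvester_index p D, D = C \/ form_lt D C & g = formH D]).

End Forms.

(* Main.v *)
Require Import Defs.
From mathcomp Require Import all_boot all_order all_algebra all_fingroup.
From mathcomp Require Import zify.

(** Every generator in sight is, up to sign, a difference of two monomials,
    leading monomial minus tail, so the ideal generated by the forms up to C
    is governed by a rewriting system on monomials.  Its rules are
      K_{i,l} (i < l) :  x_l^a y_i          -->  x_i^a y_l,
      H_E             :  x_E^(a-eb) w^e     -->  x_{E^c}^(eb) x_E^(eb-a) y_E,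
    where e = #|E| and subtractions are truncated; H_E is L_i when E = {i}, and
    truncation makes the same formula cover the last Sylvester form.

    All rules preserve the toric degree, given by deg_y + deg_w and by the
    exponents of the x_i, where y_i is counted with weight a and w with weight
    b in each coordinate.  Two monomials with equal toric degree and equal
    power of w are already joined by decreasing K-steps (toric_connected).
    Hence two rewritings of one monomial M are reconciled as soon as both can
    be continued to the same power of w.  Let D be nonempty, of size d, such
    that all smaller nonempty sets and all singletons index available rules.
    If M is rewritten by H_D and by H_E with e <= d, continue the second
    result with H_F, where F is a subset of D \ E of size d - e.  If M is
    rewritten by H_D and by K_{i,l}, continue the second result with L_i, which
    applies since x_i^a is now present, and then with H_F, where F is a subset
    of D \ {l} of size d - 1; an empty F means no further step.
    This is local_confluence; it only compares sizes of sets, and H_D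
    itself need not be an available rule.

    Applied to two available rules it gives confluence, hence a normal form nf
    on monomials such that, for each monomial Z, the sum of the coefficients of
    f over the monomials with normal form Z vanishes for f in the ideal I
    (nfcoef_ruleI).  As rules decrease the lexicographic order, the initial
    monomial of a nonzero element of I is reducible (in_monom_reducible): the
    rules form a Groebner basis.

    Applied to an available rule and the next form H_D = u - v it shows that
    X^m H_D is in I whenever m u is reducible (ruleI_mul_next).  Conversely, if
    g H_D is in I, then m u is reducible for every monomial m of g: for the
    largest m violating this, the functional attached to Z = m u takes on g H_D
    the coefficient of m in g as value (colon_next).  So both colon ideals are
    spanned by the monomials m with m u reducible. *)

Set Implicit Arguments.
Unset Strict Implicit.
Unset Printing Implicit Defensive.

(** * Monomials, rewriting rules and toric degree *)

Lemma ltn_sum_strict (I : finType) (F G : I -> nat) (i0 : I) :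
  (forall i, F i <= G i) -> F i0 < G i0 -> \sum_i F i < \sum_i G i.
Proof.
move=> leFG ltFG; rewrite (bigD1 i0) //= [X in _ < X](bigD1 i0) //=.
by rewrite -addSn leq_add // leq_sum.
Qed.

Lemma sum_eq_exists_lt (I : finType) (F G : I -> nat) (i0 : I) :
  \sum_i F i = \sum_i G i -> F i0 < G i0 -> exists i, G i < F i.
Proof.
move=> eqFG ltFG; apply/existsP; apply: contraPT eqFG.
move=> /existsPn leFG; apply/eqP; rewrite neq_ltn.
by rewrite (@ltn_sum_strict _ F G i0) // => i; rewrite leqNgt leFG.
Qed.

Section Monomials.
Variable n : nat.
Local Notation Mon := 'X_{1..1 + (n + n)}.

(** The monomial w^c x^al y^be. *)
Definition mon (c : nat) (al be : 'I_n -> nat) : Mon :=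
  [multinom match split v with
            | inl _ => c
            | inr u => match split u with inl i => al i | inr i => be i end
            end | v < 1 + (n + n)].

Lemma mon_w c al be : mon c al be (w_idx n) = c.
Proof. by rewrite mnmE /w_idx (unsplitK (inl _ ord0)). Qed.

Lemma mon_x c al be i : mon c al be (x_idx i) = al i.
Proof.
by rewrite mnmE /x_idx (unsplitK (inr _ (lshift n i))) (unsplitK (inl _ i)).
Qed.

Lemma mon_y c al be i : mon c al be (y_idx i) = be i.
Proof.
by rewrite mnmE /y_idx (unsplitK (inr _ (rshift n i))) (unsplitK (inr _ i)).
Qed.

Definition monE := (@mnmDE (1 + (n + n)), @mnmBE (1 + (n + n)), mon_w, mon_x, mon_y).

Lemma var_ind (P : 'I_(1 + (n + n)) -> Prop) :
  P (w_idx n) -> (forall i, P (x_idx i)) -> (forall i, P (y_idx i)) ->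
  forall v, P v.
Proof.
move=> Pw Px Py v; rewrite -(splitK v); case: (split v) => [o|u] /=.
  by rewrite ord1.
by rewrite -(splitK u); case: (split u).
Qed.

Lemma mon_ext (M M' : Mon) : M (w_idx n) = M' (w_idx n) ->
  (forall i, M (x_idx i) = M' (x_idx i)) ->
  (forall i, M (y_idx i) = M' (y_idx i)) -> M = M'.
Proof. by move=> *; apply/mnmP; apply: var_ind. Qed.

Lemma mon_le (M M' : Mon) : M (w_idx n) <= M' (w_idx n) ->
  (forall i, M (x_idx i) <= M' (x_idx i)) ->
  (forall i, M (y_idx i) <= M' (y_idx i)) -> (M <= M')%MM.
Proof. by move=> *; apply/mnm_lepP; apply: var_ind. Qed.

Variables a b : nat.

(** Rules: inl (i, l) stands for K_{i,l}, oriented for i < l, and inr E for H_E,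
    which is L_i when E = {i}. *)
Definition rule : finType := (('I_n * 'I_n) + {set 'I_n})%type.
Implicit Types (r : rule) (M : Mon).

(** Leading monomial and tail of a rule.  For H_E one of the two truncated
    differences a - #|E| * b and #|E| * b - a is zero; the second is nonzero at
    most for the last Sylvester form. *)
Definition lead r : Mon :=
  match r with
  | inl (i, l) => mon 0 (fun h => if h == l then a else 0) (fun h => h == i)
  | inr E => mon #|E| (fun h => if h \in E then a - #|E| * b else 0) (fun=> 0)
  end.

Definition tail r : Mon :=
  match r with
  | inl (i, l) => mon 0 (fun h => if h == i then a else 0) (fun h => h == l)
  | inr E => mon 0 (fun h => if h \in E then #|E| * b - a else #|E| * b)
                   (fun h => h \in E)
  end.

(** The result of applying the rule r to M, meaningful when lead r divides M. *)
Definition move r M : Mon := (M - lead r + tail r)%MM.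

Lemma move_add r M : move r (M + lead r)%MM = (M + tail r)%MM.
Proof. by rewrite /move addmK. Qed.

(** The degree in the variables y. *)
Definition ydeg M := \sum_i M (y_idx i).

Lemma ydegD M M' : ydeg (M + M')%MM = ydeg M + ydeg M'.
Proof. by rewrite /ydeg -big_split; apply: eq_bigr => i _; rewrite mnmDE. Qed.

Lemma ydeg_mon c al be : ydeg (mon c al be) = \sum_i be i.
Proof. by apply: eq_bigr => i _; rewrite mon_y. Qed.

(** Equality of the images of two monomials under the parametrization
    y_i = x_i^a t, w = (x_1 ... x_n)^b t of the Rees algebra. *)
Definition same_toric M M' :=
  ydeg M + M (w_idx n) = ydeg M' + M' (w_idx n) /\
  forall i, M (x_idx i) + a * M (y_idx i) + b * M (w_idx n)
          = M' (x_idx i) + a * M' (y_idx i) + b * M' (w_idx n).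

Lemma same_toric_sym M M' : same_toric M M' -> same_toric M' M.
Proof. by case=> h1 h2; split=> [//|i]; rewrite h2. Qed.

Lemma same_toric_trans M2 M1 M3 :
  same_toric M1 M2 -> same_toric M2 M3 -> same_toric M1 M3.
Proof. by case=> h1 h2 [h3 h4]; split=> [|i]; rewrite ?h1 // h2. Qed.

Lemma same_toricD M1 M2 M3 :
  same_toric M2 M3 -> same_toric (M1 + M2)%MM (M1 + M3)%MM.
Proof.
case=> h1 h2; split=> [|i]; last by have := h2 i; rewrite !mnmDE; lia.
by rewrite !ydegD !mnmDE; lia.
Qed.

Lemma sum_nat_of_bool (P : pred 'I_n) : \sum_h (P h : nat) = #|P|.
Proof.
rewrite -sum1_card [RHS]big_mkcond; apply: eq_bigr => h _.
by rewrite unfold_in; case: (P h).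
Qed.

Lemma same_toric_rule r : same_toric (lead r) (tail r).
Proof.
case: r => [[i l]|E]; split=> [|h]; rewrite /lead /tail.
- by rewrite !ydeg_mon !mon_w !(sum_nat_of_bool (pred1 _)) !card1.
- by rewrite !monE; case: (h == i); case: (h == l); rewrite /= ?muln0 ?muln1; lia.
- by rewrite !ydeg_mon !mon_w big1 // (sum_nat_of_bool (mem E)) addn0.
- rewrite !monE (mulnC b); case: (h \in E); rewrite /= ?muln0 ?muln1; lia.
Qed.

Lemma same_toric_move r M : (lead r <= M)%MM -> same_toric M (move r M).
Proof.
by move=> le_rM; rewrite -{1}(submK le_rM); exact/same_toricD/same_toric_rule.
Qed.

(** A natural number that every rule decreases: x_i has weight i + 1 (ordinals
    start at 0) and #|E| factors w outweigh the tail of H_E. *)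
Definition wweight := b * (\sum_(i < n) i.+1) + 1.
Definition weight M := wweight * M (w_idx n) + \sum_(i < n) i.+1 * M (x_idx i).

Lemma weightD M M' : weight (M + M')%MM = weight M + weight M'.
Proof.
rewrite /weight !mnmDE; under eq_bigr do rewrite mnmDE mulnDr.
by rewrite big_split /=; lia.
Qed.

(** The rules that decrease the weight. *)
Definition decreasing r := match r with
  | inl (i, l) => i < l | inr E => 0 < #|E| end.

Lemma weight_rule r : 0 < a -> decreasing r -> weight (tail r) < weight (lead r).
Proof.
move=> a_gt0; case: r => [[i l]|E] /= dec; rewrite /weight !monE.
  have sumE (h : 'I_n) :
      \sum_(j < n) j.+1 * (if j == h then a else 0) = h.+1 * a.
    by rewrite (bigD1 h) //= eqxx big1 ?addn0 // => j /negPf->; rewrite muln0.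
  under eq_bigr do rewrite mon_x.
  under [in X in _ < X]eq_bigr do rewrite mon_x.
  by rewrite !sumE; nia.
rewrite muln0 add0n; apply: leq_ltn_trans (_ : #|E| * b * \sum_(i < n) i.+1 < _).
  rewrite big_distrr /= leq_sum // => i _; rewrite mon_x mulnC leq_mul2r.
  by case: ifP => _; rewrite ?leqnn ?leq_subr orbT.
rewrite /wweight -mulnA mulnDl mul1n [X in X + #|E| + _]mulnC -addnA.
rewrite -[X in X < _]addn0 ltn_add2l.
by rewrite addn_gt0 dec.
Qed.

Lemma weight_move r M : 0 < a -> decreasing r -> (lead r <= M)%MM ->
  weight (move r M) < weight M.
Proof.
move=> a_gt0 dec le_rM; rewrite -{2}(submK le_rM) !weightD ltn_add2l.
exact: weight_rule.
Qed.

(** * Local confluence *)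

(** Below, e is an equivalence relation; the lemmas assume that it contains the
    rewriting steps they use, from monomials of weight below W. *)
Section Connected.
Hypothesis a_gt0 : 0 < a.
Variables (e : Mon -> Mon -> Prop) (W : nat).
Hypothesis e_refl : forall M, e M M.
Hypothesis e_sym : forall M M', e M M' -> e M' M.
Hypothesis e_trans : forall M1 M2 M3, e M1 M2 -> e M2 M3 -> e M1 M3.

(** Two monomials with the same toric degree and the same power of w differ by
    a chain of K-moves.  Choosing i with more y_i on the left and l with more
    y_l on the right, the decreasing K-move between the two applies to one of
    the monomials and brings them closer, so the weights never grow. *)
Lemma toric_connected :
  (forall (i l : 'I_n) M, i < l -> (lead (inl (i, l)) <= M)%MM ->
     weight M < W -> e M (move (inl (i, l)) M)) ->
  forall M M', weight M < W -> weight M' < W ->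
    M (w_idx n) = M' (w_idx n) -> same_toric M M' -> e M M'.
Proof.
move=> eK M M'.
pose d M M' := \sum_i ((M (y_idx i) - M' (y_idx i)) + (M' (y_idx i) - M (y_idx i))).
have [k] := ubnP (d M M'); elim: k M M' => // k IHk M M' le_dk ltM ltM' eqw tor.
(* when i < l, the move K_{i,l} applies to P and brings it closer to Q *)
have swap (P Q : Mon) (i l : 'I_n) : i < l -> P (w_idx n) = Q (w_idx n) ->
    same_toric P Q -> Q (y_idx i) < P (y_idx i) -> P (y_idx l) < Q (y_idx l) ->
    [/\ (lead (inl (i, l)) <= P)%MM, d (move (inl (i, l)) P) Q < d P Q,
        move (inl (i, l)) P (w_idx n) = Q (w_idx n) &
        same_toric (move (inl (i, l)) P) Q].
  move=> lt_il eqPQ torPQ lti ltl; case: (torPQ) => _ /(_ l) torl.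
  have le_P : (lead (inl (i, l)) <= P)%MM.
    apply: mon_le => [|h|h]; rewrite !monE //; case: eqP => // ->; last by lia.
    by nia.
  split=> //.
  - have il : (i == l) = false by apply/eqP => il; move: lt_il; rewrite il ltnn.
    apply: (@ltn_sum_strict _ _ _ i) => [h|]; rewrite !monE /=.
      by case: eqP => [->|_]; case: eqP => [->|_]; lia.
    by rewrite eqxx il; lia.
  - by rewrite !monE; lia.
  - exact: same_toric_trans (same_toric_sym (same_toric_move le_P)) torPQ.
have dC (P Q : Mon) : d P Q = d Q P by apply: eq_bigr => h _; rewrite addnC.
have eqy : ydeg M = ydeg M' by case: tor => t _; lia.
have [/existsP[i lti]|noi] := boolP [exists i, M' (y_idx i) < M (y_idx i)].
  have [l ltl] := sum_eq_exists_lt (esym eqy) lti.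
  case: (ltngtP i l) => [lt_il|lt_li|/val_inj eq_il]; last first.
  - by move: lti ltl; rewrite eq_il; lia.
  - have tor' := same_toric_sym tor.
    have [leM' lt_d eqw' tor''] := swap _ _ _ _ lt_li (esym eqw) tor' ltl lti.
    apply: e_trans (e_sym (eK _ _ _ lt_li leM' ltM')).
    apply: IHk => //; first by rewrite dC; move: lt_d; rewrite (dC M' M); lia.
    + exact: ltn_trans (@weight_move (inl (l, i)) _ a_gt0 lt_li leM') ltM'.
    + exact: same_toric_sym.
  - have [leM lt_d eqw' tor''] := swap _ _ _ _ lt_il eqw tor lti ltl.
    apply: e_trans (eK _ _ _ lt_il leM ltM) _; apply: IHk => //; first by lia.
    exact: ltn_trans (@weight_move (inl (i, l)) _ a_gt0 lt_il leM) ltM.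
suff -> : M = M' by [].
have eqyh h : M (y_idx h) = M' (y_idx h).
  apply/eqP; rewrite eqn_leq leqNgt (existsPn noi) /= leqNgt.
  apply/negP => lth; move/existsP: noi; apply.
  exact: sum_eq_exists_lt eqy lth.
case: tor => _ torx; apply: mon_ext => // h.
by have := torx h; rewrite eqyh eqw; lia.
Qed.

Variable G : pred {set 'I_n}.
(** The available rules: all K_{i,l} with i < l, and H_E for E in G. *)
Definition valid r := match r with inl (i, l) => i < l | inr E => G E end.
Hypothesis G_gt0 : forall E, G E -> 0 < #|E|.
Hypothesis G1 : forall i, G [set i].
Hypothesis le_ba : b <= a.

Lemma valid_dec r : valid r -> decreasing r.
Proof. by case: r => [[i l]|E] //=; exact: G_gt0. Qed.

Lemma card_subset_exists (A : {set 'I_n}) k : k <= #|A| ->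
  exists2 F : {set 'I_n}, F \subset A & #|F| = k.
Proof.
move=> le_kA; exists [set h in take k (enum A)].
  apply/subsetP => h; rewrite inE => /mem_take; by rewrite mem_enum.
rewrite cardsE (card_uniqP _) ?take_uniq ?enum_uniq // size_take_min -cardE.
exact/minn_idPl.
Qed.

(** The rule H_D need not be available; only smaller sets must be. *)
Lemma local_confluence (D : {set 'I_n}) r M :
  (forall M' r', valid r' -> (lead r' <= M')%MM -> weight M' < W ->
     e M' (move r' M')) ->
  0 < #|D| -> (forall F : {set 'I_n}, 0 < #|F| < #|D| -> G F) ->
  (forall E, r = inr E -> #|E| <= #|D|) ->
  valid r -> (lead r <= M)%MM -> (lead (inr D) <= M)%MM -> weight M <= W ->
  e (move r M) (move (inr D) M).
Proof.
move=> eV D_gt0 GD rD vr le_rM le_DM leW.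
have eK (i l : 'I_n) M' : i < l -> (lead (inl (i, l)) <= M')%MM ->
    weight M' < W -> e M' (move (inl (i, l)) M') by move=> *; exact: eV.
have ltD := weight_move a_gt0 (D_gt0 : decreasing (inr D)) le_DM.
have ltr := weight_move a_gt0 (valid_dec vr) le_rM.
have torr := same_toric_sym (same_toric_move le_rM).
have torD := same_toric_move le_DM.
have wD : #|D| <= M (w_idx n).
  by have /mnm_lepP/(_ (w_idx n)) := le_DM; rewrite mon_w.
have xD h : h \in D -> a - #|D| * b <= M (x_idx h).
  by move=> hD; have /mnm_lepP/(_ (x_idx h)) := le_DM; rewrite mon_x hD.
(* toric_connected applies once the power of w is that of move (inr D) M *)
have finish M' : weight M' < W -> same_toric M M' ->
    M' (w_idx n) = M (w_idx n) - #|D| -> e M' (move (inr D) M).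
  move=> ltM' torM' wM'; apply: toric_connected => //.
  - exact: leq_trans ltD leW.
  - by rewrite wM' !monE addn0.
  - exact: same_toric_trans (same_toric_sym torM') torD.
(* at most one H_F with #|F| < #|D| suffices to reach that power of w *)
have pull (F : {set 'I_n}) M' : weight M' < W -> same_toric M M' ->
    M' (w_idx n) = M (w_idx n) - #|D| + #|F| -> (#|F| < #|D|) ->
    (forall h, h \in F -> a - #|F| * b <= M' (x_idx h)) ->
    e M' (move (inr D) M).
  move=> ltM' torM' wM' ltFD xF.
  case: (posnP #|F|) => [F0|F_gt0]; first by apply: finish; rewrite ?wM' ?F0 ?addn0.
  have vF : valid (inr F) by apply: GD; rewrite F_gt0.
  have le_FM' : (lead (inr F) <= M')%MM.
    apply: mon_le => [|h|h]; rewrite !monE //; last by case: ifP => // /xF.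
    by rewrite wM'; lia.
  apply: e_trans (eV _ _ vF le_FM' ltM') _; apply: finish.
  - exact: ltn_trans (weight_move a_gt0 (valid_dec vF) le_FM') ltM'.
  - exact: same_toric_trans torM' (same_toric_move le_FM').
  - by rewrite !monE wM'; lia.
case: r rD vr le_rM ltr torr => [[i l]|E] rD vr le_rM ltr torr.
- (* after K_{i,l} the variable x_i occurs with exponent at least a: use L_i *)
  set M1 := move _ M in ltr torr *.
  have xM : a <= M (x_idx l).
    by have /mnm_lepP/(_ (x_idx l)) := le_rM; rewrite mon_x eqxx.
  have vi : valid (inr [set i]) by exact: G1.
  have le_iM1 : (lead (inr [set i]) <= M1)%MM.
    apply: mon_le => [|h|h]; rewrite !monE // ?cards1 ?inE; first by lia.
    by case: eqP => // ->; lia.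
  have ltM1 := leq_trans ltr leW.
  apply: e_trans (eV _ _ vi le_iM1 ltM1) _.
  have lt2 := weight_move a_gt0 (valid_dec vi) le_iM1.
  have [|F sub_F card_F] := @card_subset_exists (D :\ l) #|D|.-1.
    by rewrite (cardsD1 l D); case: (l \in D); rewrite ?leq_pred ?leqnn.
  apply: (pull F).
  + exact: ltn_trans ltM1.
  + exact: same_toric_trans (same_toric_sym torr) (same_toric_move le_iM1).
  + by rewrite !monE cards1 card_F; lia.
  + by rewrite card_F; lia.
  + move=> h hF; have := subsetP sub_F h hF; rewrite !inE => /andP[hl hD].
    rewrite !monE !inE cards1 (negPf hl) card_F.
    have := xD h hD; have -> : #|D|.-1 * b = #|D| * b - b by nia.
    have : b <= #|D| * b by nia.
    by case: eqP; lia.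
- have leED : #|E| <= #|D| by exact: rD.
  have E_gt0 := valid_dec vr : 0 < #|E|.
  have [|F sub_F card_F] := @card_subset_exists (D :\: E) (#|D| - #|E|).
    rewrite cardsD leq_sub2l //.
    by rewrite subset_leq_card // subsetIr.
  apply: (pull F).
  + exact: leq_trans ltr leW.
  + exact: same_toric_sym.
  + by rewrite !monE card_F; lia.
  + by rewrite card_F; lia.
  + move=> h hF; have := subsetP sub_F h hF; rewrite !inE => /andP[hE hD].
    rewrite !monE (negPf hE) card_F mulnBl; have := xD h hD.
    by lia.
Qed.

End Connected.
End Monomials.

(** * The lexicographic order and initial monomials *)

Section Lex.
Import Order.TTheory.

Lemma map_lexi_lt (T : eqType) (A B : seq T) (v : T) (f g : T -> nat) :
  {in A, f =1 g} -> f v < g v ->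
  ([seq f u | u <- A ++ v :: B] < [seq g u | u <- A ++ v :: B] :> seqlexi nat)%O.
Proof.
move=> eq_fg lt_v; elim: A eq_fg => [|u A IHA] eq_fg /=.
  by rewrite ltxi_cons leEnat ltnW //= leqNgt lt_v.
rewrite ltxi_cons (eq_fg u) ?mem_head // lexx /=.
by apply: IHA => z zA; rewrite eq_fg // inE zA orbT.
Qed.

Lemma map_lexi_leD (T : eqType) (A : seq T) (h f g : T -> nat) :
  ([seq f u | u <- A] <= [seq g u | u <- A] :> seqlexi nat)%O ->
  ([seq h u + f u | u <- A] <= [seq h u + g u | u <- A] :> seqlexi nat)%O.
Proof.
elim: A => [|u A IHA] //=; rewrite !lexi_cons !leEnat !leq_add2l.
by case/andP=> -> /implyP le_t; apply/implyP=> /le_t; exact: IHA.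
Qed.

Variables (n : nat) (s : 'S_n).
Local Notation Mon := 'X_{1..1 + (n + n)}.
Implicit Types M P : Mon.

Lemma mem_var_seq v : v \in var_seq s.
Proof.
elim/var_ind: v => [|i|i]; rewrite inE mem_cat ?eqxx //.
  by rewrite map_f ?orbT // mem_rev mem_enum.
have -> : y_idx i = y_idx (s (s^-1 i)%g) by rewrite permKV.
by rewrite (map_f (fun j => y_idx (s j))) ?orbT // mem_enum.
Qed.

Lemma lex_key_inj : injective (@lex_key n s).
Proof.
by move=> M P /eq_in_map eqMP; apply/mnmP => v; apply: eqMP; exact: mem_var_seq.
Qed.

Lemma lex_leD M P Q : lex_le s P Q -> lex_le s (M + P)%MM (M + Q)%MM.
Proof.
rewrite /lex_le /lex_key => /map_lexi_leD - /(_ M).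
by under eq_map do rewrite -mnmDE; under [in X in (_ <= X)%O]eq_map do rewrite -mnmDE.
Qed.

Lemma rev_enum_split (l : 'I_n) :
  exists A B, rev (enum 'I_n) = A ++ l :: B /\ {in A, forall h : 'I_n, l < h}.
Proof.
have : sorted (fun h h' : 'I_n => h' < h) (rev (enum 'I_n)).
  by have := iota_ltn_sorted 0 n; rewrite rev_sorted -val_enum_ord sorted_map.
have : l \in rev (enum 'I_n) by rewrite mem_rev mem_enum.
case/splitPr => A B; rewrite sorted_pairwise; last first.
  by move=> x y z /= lt1 lt2; exact: ltn_trans lt2 lt1.
rewrite pairwise_cat => /andP[/allrelP Al _]; exists A, B; split=> // h hA.
by apply: Al => //; exact: mem_head.
Qed.

Variables a b : nat.

(** A rule lowers the power of x_l without touching w and the larger x_h (for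
    K_{i,l}), or lowers the power of w (for H_E). *)
Lemma lex_move (r : rule n) M : 0 < a -> decreasing r -> (lead a b r <= M)%MM ->
  (lex_key s (move a b r M) < lex_key s M)%O.
Proof.
move=> a_gt0; case: r => [[i l]|E] dec /mnm_lepP le_rM; last first.
  rewrite /lex_key /var_seq /=; apply: (@map_lexi_lt _ [::]) => //.
  have := le_rM (w_idx n); rewrite !monE addn0 => leE.
  by rewrite ltn_subrL (leq_trans dec leE) andbT.
have [A [B [eqAB gtA]]] := rev_enum_split l.
have eqs : var_seq s = (w_idx n :: [seq x_idx h | h <- A]) ++
    x_idx l :: ([seq x_idx h | h <- B] ++ [seq y_idx (s h) | h <- enum 'I_n]).
  by rewrite /var_seq eqAB map_cat /= -catA.
rewrite /lex_key eqs; apply: map_lexi_lt.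
  move=> v; rewrite inE => /predU1P[->|/mapP[h hA ->]]; rewrite !monE; first by lia.
  have lt_lh := gtA h hA; have lt_il : i < l := dec.
  have -> : (h == l) = false by apply/eqP => e; move: lt_lh; rewrite e ltnn.
  have -> : (h == i) = false by apply/eqP => e; move: lt_lh; rewrite e ltnNge ltnW.
  by rewrite subn0 addn0.
have lt_il : i < l := dec.
have := le_rM (x_idx l); rewrite !monE eqxx.
have -> : (l == i) = false by apply/eqP => e; move: lt_il; rewrite e ltnn.
by lia.
Qed.

Lemma lex_max_exists (T : seq Mon) : T != [::] ->
  exists2 m, m \in T & {in T, forall m', lex_le s m' m}.
Proof.
elim: T => [|m T IHT] // _; case: (eqVneq T [::]) => [->|T0].
  by exists m; rewrite ?mem_head // => m'; rewrite inE => /eqP->; exact: lexx.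
have [z zT maxz] := IHT T0.
case: (leP (lex_key s m) (lex_key s z)) => [le_mz|lt_zm].
  by exists z; rewrite ?inE ?zT ?orbT // => m' /predU1P[->|/maxz].
exists m; rewrite ?mem_head // => m' /predU1P[->|/maxz le_z]; first exact: lexx.
exact: le_trans le_z (ltW lt_zm).
Qed.

End Lex.

Section InMonom.
Import Order.TTheory GRing.Theory.
Variables (n : nat) (s : 'S_n) (k : fieldType).
Local Open Scope ring_scope.
Implicit Type f : {mpoly k[1 + (n + n)]}.

Lemma in_monomP f : f != 0 -> in_monom s f \in msupp f /\
  {in msupp f, forall m, lex_le s m (in_monom s f)}.
Proof.
rewrite -msupp_eq0 => /(lex_max_exists s)[z zf maxz].
suff : in_monom s f \in [seq m <- msupp f | all (fun m' => lex_le s m' m) (msupp f)].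
  by rewrite mem_filter => /andP[/allP ? ->].
rewrite /in_monom.
have : z \in [seq m <- msupp f | all (fun m' => lex_le s m' m) (msupp f)].
  by rewrite mem_filter zf andbT; apply/allP.
by case: (filter _ _) => // y t _; exact: mem_head.
Qed.

Lemma in_monomE f m : m \in msupp f ->
  {in msupp f, forall m', lex_le s m' m} -> in_monom s f = m.
Proof.
move=> mf maxm.
have f0 : f != 0 by rewrite -msupp_eq0; apply: contraTneq mf => ->.
have [inf maxf] := in_monomP f0.
apply: (@lex_key_inj _ s); apply/le_anti; apply/andP.
by split; [exact: maxm|exact: maxf].
Qed.

Lemma in_term_binomial (u v : 'X_{1..1 + (n + n)}) :
  (lex_key s v < lex_key s u)%O ->
  in_term s ('X_[u] - 'X_[v] : {mpoly k[1 + (n + n)]}) = 'X_[u].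
Proof.
move=> lt_vu; have vu : (v == u) = false by apply: contraTF lt_vu => /eqP->; rewrite ltxx.
have cu : ('X_[u] - 'X_[v] : {mpoly k[1 + (n + n)]})@_u = 1.
  by rewrite mcoeffB !mcoeffX eqxx vu subr0.
rewrite /in_term (@in_monomE _ u) ?cu ?scale1r //.
  by rewrite mcoeff_msupp cu oner_eq0.
move=> m /msuppB_le; rewrite !msuppX mem_cat !inE => /orP[]/eqP->; first exact: lexx.
exact: ltW.
Qed.

End InMonom.

(** * Generated ideals *)

Section IdealGen.
Import GRing.Theory.
Local Open Scope ring_scope.
Variable A : comNzRingType.
Implicit Types (G : A -> Prop) (f g c : A).

Lemma ideal_gen0 G : ideal_gen G 0.
Proof. by exists 0, (fun=> 0), (fun=> 0); split=> [[]//|]; rewrite big_ord0. Qed.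

Lemma ideal_gen_mem G g : G g -> ideal_gen G g.
Proof.
by move=> Gg; exists 1, (fun=> 1), (fun=> g); rewrite big_ord1 mul1r.
Qed.

Lemma ideal_genD G f g : ideal_gen G f -> ideal_gen G g -> ideal_gen G (f + g).
Proof.
move=> [m1 [c1 [g1 [G1 ->]]]] [m2 [c2 [g2 [G2 ->]]]].
exists (m1 + m2)%N.
exists (fun i => match split i with inl j => c1 j | inr j => c2 j end).
exists (fun i => match split i with inl j => g1 j | inr j => g2 j end).
split=> [i|]; first by case: (split i).
rewrite big_split_ord /=; congr (_ + _); apply: eq_bigr => i _.
  by rewrite (unsplitK (inl _ i)).
by rewrite (unsplitK (inr _ i)).
Qed.

Lemma ideal_genM G c f : ideal_gen G f -> ideal_gen G (c * f).
Proof.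
move=> [m [d [g [Gg ->]]]]; exists m, (fun i => c * d i), g; split=> //.
by rewrite big_distrr /=; apply: eq_bigr => i _; rewrite mulrA.
Qed.

Lemma ideal_genN G f : ideal_gen G f -> ideal_gen G (- f).
Proof. by rewrite -mulN1r; exact: ideal_genM. Qed.

Lemma ideal_gen_sum G (I : eqType) (r : seq I) (F : I -> A) :
  {in r, forall i, ideal_gen G (F i)} -> ideal_gen G (\sum_(i <- r) F i).
Proof.
move=> GF; rewrite big_seq; apply: big_ind => //; first exact: ideal_gen0.
exact: ideal_genD.
Qed.

Lemma ideal_gen_ind G (P : A -> Prop) :
  P 0 -> (forall f g, P f -> P g -> P (f + g)) ->
  (forall c g, G g -> P (c * g)) -> forall f, ideal_gen G f -> P f.
Proof.
by move=> P0 PD PM f [m [c [g [Gg ->]]]]; apply: big_ind => // i _; exact: PM.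
Qed.

Lemma ideal_gen_sub G G' : (forall g, G g -> ideal_gen G' g) ->
  forall f, ideal_gen G f -> ideal_gen G' f.
Proof.
move=> sub; apply: ideal_gen_ind => [|f g|c g Gg].
- exact: ideal_gen0.
- exact: ideal_genD.
- exact/ideal_genM/sub.
Qed.

End IdealGen.

(** * Normal forms *)

Section Rewriting.
Import Order.TTheory GRing.Theory.
Variables (n a b : nat) (s : 'S_n).
Local Notation Mon := 'X_{1..1 + (n + n)}.
Implicit Types (M : Mon) (r : rule n).
Hypotheses (b_gt0 : 0 < b) (le_ba : b <= a).
Variable G : pred {set 'I_n}.
Hypothesis G_gt0 : forall E, G E -> 0 < #|E|.
Hypothesis G1 : forall i, G [set i].
Hypothesis Gdown : forall E F : {set 'I_n}, G E -> 0 < #|F| < #|E| -> G F.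

Let a_gt0 : 0 < a. Proof. exact: leq_trans le_ba. Qed.

(** Divisible by the leading monomial of an available rule. *)
Definition reducible M := [exists r, valid G r && (lead a b r <= M)%MM].

(** One rewriting step, by some applicable rule; the identity on irreducible
    monomials. *)
Definition step M :=
  if [pick r | valid G r && (lead a b r <= M)%MM] is Some r then move a b r M else M.

(** The normal form; weight b M steps are enough to reach it. *)
Definition nf M := iter (weight b M) step M.

Lemma step_irred M : ~~ reducible M -> step M = M.
Proof.
by rewrite /step => irr; case: pickP => // r rM; case/existsP: irr; exists r.
Qed.

Lemma step_red M : reducible M ->
  exists r, [/\ valid G r, (lead a b r <= M)%MM & step M = move a b r M].
Proof.
case/existsP=> r rM; rewrite /step; case: pickP => [r' /andP[]|/(_ r)].
  by exists r'.
by rewrite rM.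
Qed.

Lemma iter_step_irred M i : ~~ reducible M -> iter i step M = M.
Proof. by move=> irr; elim: i => //= i ->; exact: step_irred. Qed.

Lemma nf_irred M : ~~ reducible M -> nf M = M.
Proof. exact: iter_step_irred. Qed.

Lemma weight_step M : reducible M -> weight b (step M) < weight b M.
Proof.
case/step_red=> r [vr le_rM ->]; apply: weight_move => //.
exact: valid_dec vr.
Qed.

Lemma iter_step M i : weight b M <= i -> iter i step M = nf M.
Proof.
have [m] := ubnP (weight b M); elim: m M i => // m IHm M i lt_m le_i.
have [red|irr] := boolP (reducible M); last by rewrite nf_irred // iter_step_irred.
have lt_step := weight_step red.
rewrite /nf; case: (weight b M) (lt_step) le_i lt_m => // j lt_j.
case: i => // i le_i lt_m; rewrite !iterSr IHm ?IHm //; lia.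
Qed.

Lemma nf_step M : nf (step M) = nf M.
Proof.
have [red|irr] := boolP (reducible M); last by rewrite step_irred.
rewrite -(@iter_step (step M) (weight b M)) ?(ltnW (weight_step red)) //.
by rewrite -iterSr iter_step.
Qed.

(** Confluence: the normal form does not depend on the rules applied. *)
Lemma nf_move r M : valid G r -> (lead a b r <= M)%MM -> nf (move a b r M) = nf M.
Proof.
have [m] := ubnP (weight b M); elim: m r M => // m IHm r M lt_m vr le_rM.
rewrite -(nf_step M).
have red : reducible M by apply/existsP; exists r; rewrite vr.
have [r' [vr' le_r'M ->]] := step_red red.
have eV M' q : valid G q -> (lead a b q <= M')%MM -> weight b M' < weight b M ->
    nf M' = nf (move a b q M').
  by move=> vq le_q lt_M'; rewrite IHm //; lia.
have conf := fun D r => @local_confluence n a b a_gt0 (fun M M' => nf M = nf M')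
  (weight b M) (fun _ => erefl) (fun _ _ => esym) (fun _ _ _ => @etrans _ _ _ _)
  G G_gt0 G1 le_ba D r M eV.
have Gr D : valid G (inr D) ->
    0 < #|D| /\ (forall F : {set 'I_n}, 0 < #|F| < #|D| -> G F).
  by move=> GD; split=> [|F]; [exact: G_gt0|exact: Gdown].
case: r r' vr vr' le_rM le_r'M => [[i l]|D] [[i' l']|D'] vr vr' le_rM le_r'M.
- (* neither K-move changes the power of w *)
  apply: (@toric_connected n a b a_gt0 (fun M M' => nf M = nf M') (weight b M)) => //.
  + by move=> ? ? ? -> ->.
  + by move=> i0 l0 M' lt0 le0 ltM'; apply: eV.
  + exact: weight_move.
  + exact: weight_move.
  + by rewrite !monE.
  + apply: same_toric_trans (same_toric_move le_r'M).
    exact/same_toric_sym/same_toric_move.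
- by have [? ?] := Gr _ vr'; apply: conf.
- by have [? ?] := Gr _ vr; apply/esym/conf.
- have [? ?] := Gr _ vr'; have [? ?] := Gr _ vr.
  case: (leqP #|D| #|D'|) => le_DD'; first by apply: conf => // E [<-].
  by apply/esym/conf => // E [<-]; exact: ltnW.
Qed.

Lemma nf_le M : lex_le s (nf M) M.
Proof.
rewrite /nf; elim: (weight b M) => [|i IHi] /=; first exact: lexx.
apply: le_trans IHi; set P := iter _ _ _.
have [red|irr] := boolP (reducible P); last by rewrite step_irred.
have [r [vr le_rP ->]] := step_red red; apply/ltW/lex_move => //.
exact: valid_dec vr.
Qed.

(** * The ideal of the rules and its initial ideal *)

Variable k : fieldType.
Local Notation S := {mpoly k[1 + (n + n)]}.
Local Open Scope ring_scope.

(** The binomial and the ideal attached to a rule and to the available rules. *)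
Definition binom r : S := 'X_[lead a b r] - 'X_[tail a b r].
Definition ruleI : S -> Prop :=
  ideal_gen (fun g => exists2 r, valid G r & g = binom r).

(** The coefficient of Z after replacing each monomial of f by its normal
    form. *)
Definition nfcoef (Z : Mon) (f : S) : k := \sum_(m <- msupp f) f@_m * (nf m == Z)%:R.

Lemma nfcoefE Z f (T : seq Mon) : uniq T -> {subset msupp f <= T} ->
  nfcoef Z f = \sum_(m <- T) f@_m * (nf m == Z)%:R.
Proof.
move=> uT sT; rewrite [RHS](bigID (fun m => m \in msupp f)) /=.
rewrite [X in _ + X]big1 ?addr0; last first.
  by move=> m /memN_msupp_eq0->; rewrite mul0r.
rewrite -big_filter; apply/perm_big/uniq_perm; rewrite ?filter_uniq ?msupp_uniq //.
by move=> m; rewrite mem_filter; case: (boolP (m \in msupp f)) => //= /sT->.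
Qed.

Lemma nfcoefD Z f g : nfcoef Z (f + g) = nfcoef Z f + nfcoef Z g.
Proof.
pose T := undup (msupp f ++ msupp g).
have uT : uniq T by exact: undup_uniq.
rewrite !(@nfcoefE Z _ T) //.
- by rewrite -big_split; apply: eq_bigr => m _; rewrite mcoeffD mulrDl.
- by move=> m mg; rewrite mem_undup mem_cat mg orbT.
- by move=> m mf; rewrite mem_undup mem_cat mf.
- by move=> m /msuppD_le; rewrite mem_undup.
Qed.

Lemma nfcoefX Z c m : nfcoef Z (c *: 'X_[m]) = c * (nf m == Z)%:R.
Proof.
rewrite (@nfcoefE Z _ [:: m]) //.
  by rewrite big_seq1 mcoeffZ mcoeffX eqxx mulr1.
by move=> m' /msuppZ_le; rewrite msuppX.
Qed.

Lemma nfcoef0 Z : nfcoef Z 0 = 0.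
Proof. by rewrite /nfcoef msupp0 big_nil. Qed.

Lemma nfcoef_sum Z (I : Type) (t : seq I) (F : I -> S) :
  nfcoef Z (\sum_(i <- t) F i) = \sum_(i <- t) nfcoef Z (F i).
Proof. by apply: (big_morph _ (nfcoefD Z)); exact: nfcoef0. Qed.

Lemma mul_binom (g : S) u v : g * ('X_[u] - 'X_[v]) =
  \sum_(m <- msupp g) (g@_m *: 'X_[m + u] + (- g@_m) *: 'X_[m + v]).
Proof.
rewrite {1}(mpolyE g) big_distrl; apply: eq_bigr => m _ /=.
by rewrite -scalerAl mulrBr -!mpolyXD scalerBr scaleNr.
Qed.

Lemma nfcoef_mul_binom Z g u v : nfcoef Z (g * ('X_[u] - 'X_[v])) =
  \sum_(m <- msupp g) g@_m * ((nf (m + u)%MM == Z)%:R - (nf (m + v)%MM == Z)%:R).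
Proof.
rewrite mul_binom nfcoef_sum; apply: eq_bigr => m _.
by rewrite nfcoefD !nfcoefX mulrBr mulNr.
Qed.

Lemma nfcoef_ruleI Z f : ruleI f -> nfcoef Z f = 0.
Proof.
move: f; apply: ideal_gen_ind => [|f g f0 g0|c _ [r vr ->]]; first exact: nfcoef0.
  by rewrite nfcoefD f0 g0 addr0.
rewrite nfcoef_mul_binom big1 // => m _.
by rewrite -(@nf_move r) ?move_add ?subrr ?mulr0 // lem_addl.
Qed.

(** The binomials of the available rules form a Groebner basis of ruleI. *)
Lemma in_monom_reducible f : ruleI f -> f != 0 -> reducible (in_monom s f).
Proof.
move=> If f0; have [inf maxf] := in_monomP s f0.
have [//|irr] := boolP (reducible (in_monom s f)).
set Z := in_monom s f in inf maxf irr *.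
suff : nfcoef Z f != 0 by rewrite nfcoef_ruleI ?eqxx.
rewrite /nfcoef (bigD1_seq Z) ?msupp_uniq //= nf_irred // eqxx mulr1 big_seq_cond.
rewrite big1 ?addr0 -?mcoeff_msupp // => m /andP[mf mZ].
have [eZ|] := eqVneq (nf m) Z; last by rewrite mulr0.
case/eqP: mZ; apply: (@lex_key_inj _ s); apply/le_anti; apply/andP; split.
  exact: maxf.
by rewrite -eZ; exact: nf_le.
Qed.

Lemma ruleI_move r M : valid G r -> (lead a b r <= M)%MM ->
  ruleI ('X_[M] - 'X_[move a b r M]).
Proof.
move=> vr le_rM; rewrite /move -{1}(submK le_rM) !mpolyXD -mulrBr.
by apply/ideal_genM/ideal_gen_mem; exists r.
Qed.

(** * The colon ideal by the next form *)

Variable D : {set 'I_n}.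
Hypothesis D_gt0 : (0 < #|D|)%N.
Hypothesis GD : forall F : {set 'I_n}, (0 < #|F| < #|D|)%N -> G F.
Hypothesis leGD : forall E, G E -> (#|E| <= #|D|)%N.

Local Notation u := (lead a b (inr D)).
Local Notation v := (tail a b (inr D)).

(** With M = m u and r an available rule dividing M, both X^M - X^(move r M)
    and, by local confluence, X^(move r M) - X^(m v) lie in the ideal. *)
Lemma ruleI_mul_next m : reducible (m + u)%MM -> ruleI ('X_[m] * binom (inr D)).
Proof.
case/existsP=> r /andP[vr le_r].
rewrite /binom mulrBr -!mpolyXD -(@move_add n a b (inr D)).
rewrite -[X in ruleI X](subrKA 'X_[move a b r (m + u)%MM]).
apply: ideal_genD; first exact: ruleI_move.
apply: (@local_confluence n a b a_gt0 (fun M M' => ruleI ('X_[M] - 'X_[M']))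
  (weight b (m + u)%MM) _ _ _ G G_gt0 G1 le_ba D r) => //.
- by move=> M; rewrite subrr; exact: ideal_gen0.
- by move=> M M'; rewrite -opprB => /ideal_genN; rewrite opprK.
- by move=> M1 M2 M3 I12 I23; rewrite -(subrKA 'X_[M2]); exact: ideal_genD.
- by move=> M' r' vr' le_r' _; exact: ruleI_move.
- by move=> E rE; apply: leGD; move: vr; rewrite rE.
- exact: lem_addl.
Qed.

(** A polynomial lies in the colon ideal by u - v exactly when m u is reducible
    for each of its monomials m. *)
Lemma colon_next g : ruleI (g * binom (inr D)) <->
  {in msupp g, forall m, reducible (m + u)%MM}.
Proof.
split=> [Ig|redg]; last first.
  rewrite {1}(mpolyE g) big_distrl /=; apply: ideal_gen_sum => m mg.
  by rewrite -scalerAl -mul_mpolyC; apply/ideal_genM/ruleI_mul_next/redg.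
apply/allP/negPn/negP; rewrite -has_predC has_filter.
move/(lex_max_exists s) => [m0]; rewrite mem_filter /= => /andP[irr m0g] max0.
(* m0 is the largest monomial of g with m0 u irreducible; only u * m0
   contributes to the coefficient of Z *)
pose Z := (m0 + u)%MM.
have /eqP := nfcoef_ruleI Z Ig; apply/negP.
rewrite nfcoef_mul_binom (bigD1_seq m0) ?msupp_uniq //= nf_irred // eqxx.
have lt_vu m : (lex_key s (m + v)%MM < lex_key s (m + u)%MM)%O.
  by rewrite -(@move_add n a b (inr D)); apply: lex_move => //; exact: lem_addl.
(* nf (m v) <= m v < m u <= m0 u for m <= m0 *)
have nfv m : lex_le s m m0 -> (nf (m + v)%MM == Z) = false.
  move=> le_m; apply/eqP => eZ; have := nf_le (m + v)%MM; rewrite eZ /lex_le.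
  apply/negP; rewrite -ltNge; apply: lt_le_trans (lt_vu m) _.
  by rewrite /Z ![(_ + u)%MM]addmC; exact: lex_leD.
rewrite nfv ?subr0 ?mulr1; last exact: lexx.
rewrite big_seq_cond big1 ?addr0 -?mcoeff_msupp // => m /andP[mg mm0].
have [red|irrm] := boolP (reducible (m + u)%MM).
  have := nfcoef_ruleI Z (ruleI_mul_next red).
  rewrite nfcoef_mul_binom msuppX big_seq1 mcoeffX eqxx mul1r => ->.
  by rewrite mulr0.
rewrite nf_irred // nfv; last by apply: max0; rewrite mem_filter /= irrm.
by rewrite /Z eqm_add2r (negPf mm0) subrr mulr0.
Qed.

Lemma in_ideal_msupp f : in_ideal s ruleI f -> {in msupp f, forall m, reducible m}.
Proof.
move: f; apply: ideal_gen_ind => [m|f g rf rg m|c _ [f If ->] m].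
- by rewrite msupp0.
- by move/msuppD_le; rewrite mem_cat => /orP[/rf|/rg].
have [->|f0] := eqVneq f 0; first by rewrite /in_term mcoeff0 scale0r mulr0 msupp0.
rewrite /in_term -scalerAr => /msuppZ_le; rewrite (perm_mem (msuppMX _ _)).
case/mapP=> m' _ ->; have /existsP[r /andP[vr le_r]] := in_monom_reducible If f0.
apply/existsP; exists r; rewrite vr; apply: lepm_trans le_r _; exact: lem_addr.
Qed.

Lemma in_ideal_reducible m : reducible m -> in_ideal s ruleI 'X_[m].
Proof.
case/existsP=> r /andP[vr le_r]; rewrite -(submK le_r) mpolyXD.
apply/ideal_genM/ideal_gen_mem; exists (binom r).
  by apply: ideal_gen_mem; exists r.
rewrite in_term_binomial //; have := lex_move s a_gt0 (valid_dec G_gt0 vr) (lepm_refl _).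
by move=> /(_ b); rewrite -{1}[lead a b r]add0m move_add add0m.
Qed.

Lemma colon_next_in g :
  (ruleI (g * binom (inr D)) <-> in_ideal s ruleI (g * in_term s (binom (inr D)))).
Proof.
have lt_vu : (lex_key s v < lex_key s u)%O.
  have := lex_move s a_gt0 (D_gt0 : decreasing (inr D)) (lepm_refl (lead a b (inr D))).
  by rewrite -{1}[lead a b (inr D)]add0m move_add add0m.
rewrite in_term_binomial //; split=> [/colon_next redg|/in_ideal_msupp redg].
  rewrite {1}(mpolyE g) big_distrl /=; apply: ideal_gen_sum => m mg.
  rewrite -scalerAl -mul_mpolyC -mpolyXD; apply/ideal_genM/in_ideal_reducible.
  exact: redg.
apply/colon_next => m mg; apply: redg; rewrite (perm_mem (msuppMX _ _)).
by rewrite (addmC m) map_f.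
Qed.

Lemma colon_next_monomial : monomial_ideal (colon ruleI (binom (inr D))).
Proof.
exists (fun m => reducible (m + u)%MM) => f; split=> [/colon_next redf|].
  rewrite {1}(mpolyE f); apply: ideal_gen_sum => m mf; rewrite -mul_mpolyC.
  by apply/ideal_genM/ideal_gen_mem; exists m => //; exact: redf.
move: f; apply: ideal_gen_ind => [|f g If Ig|c _ [m red ->]]; rewrite /colon.
- by rewrite mul0r; exact: ideal_gen0.
- by rewrite mulrDl; exact: ideal_genD.
- by rewrite -mulrA; apply/ideal_genM/ruleI_mul_next.
Qed.

End Rewriting.

(** * The ordering of the Sylvester forms *)

Section FormOrder.
Import Order.TTheory.

(** On sequences of equal length, the lexicographic order compares at the first
    difference. *)
Lemma ltxi_first_diff (u v : seq nat) : size u = size v ->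
  (u < v :> seqlexi nat)%O <->
  exists2 t, t < size u & (forall r, r < t -> nth 0 u r = nth 0 v r) /\
                          nth 0 u t < nth 0 v t.
Proof.
elim: u v => [|x u IHu] [|y v] //= => [_|[eq_sz]]; first by split=> // -[].
rewrite ltxi_cons leEnat; split.
  case/andP=> le_xy /implyP lt_uv; case: (ltnP x y) => [lt_xy|le_yx].
    by exists 0.
  have [t lt_t [eq_t lt_uvt]] := (IHu _ eq_sz).1 (lt_uv le_yx).
  exists t.+1 => //; split=> // -[|r] //= lt_r; last exact: eq_t.
  by apply/eqP; rewrite eqn_leq le_xy.
case=> -[|t] /= lt_t [eq_t lt_uvt]; first by rewrite ltnW //= leqNgt lt_uvt.
have /= -> := eq_t 0 isT; rewrite leqnn /=; apply/(IHu _ eq_sz); exists t => //.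
by split=> // r lt_r; exact: (eq_t r.+1).
Qed.

Variable n : nat.
Implicit Types C D E : {set 'I_n}.

Lemma size_index_seq C : size (index_seq C) = #|C|.
Proof. by rewrite size_map -cardE. Qed.

Lemma index_seq_inj : injective (@index_seq n).
Proof.
move=> C D /(inj_map val_inj) eqCD; apply/setP => i.
by rewrite -mem_enum eqCD mem_enum.
Qed.

Lemma form_ltE C D : form_lt C D <->
  (#|C| < #|D|) || ((#|C| == #|D|) && (index_seq C < index_seq D :> seqlexi nat)%O).
Proof.
split=> [[->//|[eqc H]]|/orP[|/andP[/eqP eqc H]]]; [|by left|right].
  rewrite eqc eqxx ltnn /=; apply/ltxi_first_diff; rewrite !size_index_seq //.
split=> //; move/ltxi_first_diff: H; rewrite !size_index_seq; exact.
Qed.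

Lemma form_lt_total C D : ~ (C = D \/ form_lt C D) -> form_lt D C.
Proof.
move=> ncd; apply/form_ltE; case: (ltngtP #|C| #|D|) => [lt|//|eqc] /=.
  by case: ncd; right; left.
case: (ltgtP (index_seq C : seqlexi nat) (index_seq D)) => [lt|//|/index_seq_inj eqCD].
  by case: ncd; right; apply/form_ltE; rewrite eqc eqxx lt orbT.
by case: ncd; left.
Qed.

(** Boolean version of: C = D or C comes before D. *)
Definition form_le C D := (C == D) || (#|C| < #|D|) ||
  ((#|C| == #|D|) && (index_seq C < index_seq D :> seqlexi nat)%O).

Lemma form_leP C D : reflect (C = D \/ form_lt C D) (form_le C D).
Proof.
rewrite /form_le -orbA; apply: (iffP orP) => -[eqCD|ltCD].
- by left; apply/eqP.
- by right; apply/form_ltE.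
- by left; apply/eqP.
- by right; apply/form_ltE.
Qed.

End FormOrder.

(** * The forms as binomials of rules *)

Section Forms.
Import GRing.Theory.
Variables (k : fieldType) (n a b p : nat).
Local Open Scope ring_scope.
Local Notation S := {mpoly k[1 + (n + n)]}.
Implicit Types E : {set 'I_n}.

Lemma mpolyX_mon c (al be : 'I_n -> nat) : 'X_[mon c al be] =
  Xw k n ^+ c * (\prod_i Xx k i ^+ al i * \prod_i Xy k i ^+ be i) :> S.
Proof.
rewrite mpolyXE_id !big_split_ord big_ord1 /=.
congr (_ ^+ _ * (_ * _)); first exact: (mon_w c al be).
  by apply: eq_bigr => i _; rewrite (mon_x c al be).
by apply: eq_bigr => i _; rewrite (mon_y c al be).
Qed.

Lemma prod_expr_if (F : 'I_n -> S) E e :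
  \prod_i F i ^+ (if i \in E then e else 0) = (\prod_(i in E) F i) ^+ e.
Proof.
rewrite -prodrXl [RHS]big_mkcond; apply: eq_bigr => i _.
by case: ifP; rewrite ?expr0.
Qed.

Lemma prod_expr_mem (F : 'I_n -> S) E :
  \prod_i F i ^+ (i \in E) = \prod_(i in E) F i.
Proof.
by rewrite [RHS]big_mkcond; apply: eq_bigr => i _; case: (i \in E).
Qed.

Lemma mpolyX_leadH E : 'X_[lead a b (inr E)] =
  prodx k E ^+ (a - #|E| * b) * Xw k n ^+ #|E| :> S.
Proof.
by rewrite mpolyX_mon prod_expr_if [X in _ * (_ * X)]big1 // mulr1 mulrC.
Qed.

Lemma mpolyX_tailH E : 'X_[tail a b (inr E)] =
  coprodx k E ^+ (#|E| * b) * prodx k E ^+ (#|E| * b - a) * prody k E :> S.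
Proof.
rewrite mpolyX_mon expr0 mul1r prod_expr_mem; congr (_ * _).
rewrite -!prod_expr_if -big_split; apply: eq_bigr => i _.
by rewrite /= inE; case: (i \in E); rewrite expr0 ?mul1r ?mulr1.
Qed.

Lemma formKE (i l : 'I_n) : formK k a i l = - binom a b k (inl (i, l)).
Proof.
have prod1E (F : 'I_n -> S) h e :
    \prod_j F j ^+ (if j == h then e else 0%N) = F h ^+ e.
  by rewrite (bigD1 h) //= eqxx big1 ?mulr1 // => j /negPf->; rewrite expr0.
by rewrite /binom !mpolyX_mon !prod1E !expr0 !mul1r opprB.
Qed.

Hypothesis le_ba : (b <= a)%N.

Lemma formLE (i : 'I_n) : formL k a b i = binom a b k (inr [set i]).
Proof.
rewrite /binom mpolyX_leadH mpolyX_tailH cards1 !mul1n.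
have -> : (b - a = 0)%N by apply/eqP; rewrite subn_eq0.
by rewrite expr0 mulr1 /prodx /prody !big_set1 expr1.
Qed.

Lemma formHE E : (#|E| < p)%N -> (#|E| * b <= a)%N ->
  formH k a b p E = binom a b k (inr E).
Proof.
rewrite /formH /binom mpolyX_leadH mpolyX_tailH => -> le_a.
have -> : (#|E| * b - a = 0)%N by apply/eqP; rewrite subn_eq0.
by rewrite expr0 mulr1.
Qed.

Lemma card_ord_lt : (p <= n)%N -> #|[set i : 'I_n | (i < p)%N]| = p.
Proof.
move=> le_pn; have := @big_ord_widen nat 0%N addn p n (fun=> 1%N) le_pn.
by rewrite sum1_card card_ord sum1dep_card.
Qed.

Lemma formH_last : is_sylvester_degree n a b p ->
  formH k a b p [set i : 'I_n | (i < p)%N]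
    = binom a b k (inr [set i : 'I_n | (i < p)%N]).
Proof.
rewrite /is_sylvester_degree /formH /binom mpolyX_leadH mpolyX_tailH.
have card_p := card_ord_lt.
case: ifP => [_ /andP[/andP[_ le_pn] /andP[_ le_a]]|gt_a /eqP eq_pn].
  rewrite card_p // ltnn; have -> : (a - p * b = 0)%N by apply/eqP; rewrite subn_eq0.
  by rewrite expr0 mul1r.
rewrite card_p ?eq_pn // ltnn.
have -> : [set i : 'I_n | (i < n)%N] = setT by apply/setP => i; rewrite !inE ltn_ord.
have -> : (n * b - a = 0)%N by apply/eqP; rewrite subn_eq0 ltnW // ltnNge gt_a.
by rewrite expr0 mulr1 /coprodx setCT /prodx big_set0 expr1n mul1r.
Qed.

End Forms.

Lemma sylvester_degree_gt n a b p e :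
  is_sylvester_degree n a b p -> (e < p)%N -> (e * b <= a)%N.
Proof.
rewrite /is_sylvester_degree => + lt_ep; have : (e <= p.-1)%N by lia.
case: ifP => [_ + /andP[_ /andP[+ _]]|gt_a le_e /eqP eq_pn]; first by nia.
by move: gt_a; rewrite leqNgt => /negbFE; nia.
Qed.

Lemma in_ideal_ext n (k : fieldType) (s : 'S_n) (I J : {mpoly k[1 + (n + n)]} -> Prop) :
  (forall f, I f <-> J f) -> forall f, in_ideal s I f <-> in_ideal s J f.
Proof.
move=> IJ f; split; apply: ideal_gen_sub => _ [g /IJ Ig ->];
  by apply: ideal_gen_mem; exists g.
Qed.

(** * The ideal of the forms up to C *)

Section Sylvester.
Import GRing.Theory.
Variables (k : fieldType) (n a b p : nat) (C : {set 'I_n}).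
Local Open Scope ring_scope.
Hypotheses (b_gt0 : (0 < b)%N) (lt_ba : (2 * b < a)%N).
Hypotheses (hp : is_sylvester_degree n a b p) (hC : (2 <= #|C| <= p.-1)%N).

Implicit Types E : {set 'I_n}.

(** The index sets of the forms L_i and H_E up to C. *)
Definition formset E := (0 < #|E|)%N && form_le E C.

Lemma card_form_le E : form_le E C -> (#|E| <= #|C|)%N.
Proof. by case/form_leP => [->//|[/ltnW//|[->]]]. Qed.

Lemma idealH_ruleI (f : {mpoly k[1 + (n + n)]}) :
  idealH a b p C f <-> ruleI a b formset f.
Proof.
have le_ba : (b <= a)%N by lia.
have ltCp : (#|C| < p)%N by lia.
have formE E : formset E -> formH k a b p E = binom a b k (inr E).
  case/andP=> _ /card_form_le leEC; have ltE := leq_ltn_trans leEC ltCp.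
  by apply: formHE => //; exact: sylvester_degree_gt hp ltE.
have set1 i : formset [set i].
  rewrite /formset cards1; apply/form_leP; right; left; rewrite cards1.
  by case/andP: hC.
split; apply: ideal_gen_sub => g.
  case=> [Lg|[E [idE leEC ->]]].
    move: g Lg; apply: ideal_gen_sub => _ [[i [l [lt_il ->]]]|[i ->]].
      rewrite (formKE _ _ b); apply/ideal_genN/ideal_gen_mem.
      by exists (inl (i, l)).
    rewrite formLE //; apply: ideal_gen_mem; exists (inr [set i]) => //.
    exact: set1.
  have GE : formset E.
    rewrite /formset; apply/andP; split; last exact/form_leP.
    by case/andP: idE => + _; lia.
  by rewrite formE //; apply: ideal_gen_mem; exists (inr E).
case=> -[[i l]|E] vr ->.
  rewrite -[binom _ _ _ _]opprK -formKE; apply/ideal_genN/ideal_gen_mem; left.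
  by apply: ideal_gen_mem; left; exists i, l.
have /andP[E_gt0 leEC] : formset E by [].
case: (ltngtP 1 #|E|) => [lt1|/ltnSE|/esym/eqP/cards1P[i ->]]; first last.
- rewrite -formLE //; apply/ideal_gen_mem; left; apply: ideal_gen_mem.
  by right; exists i.
- by rewrite leqNgt E_gt0.
rewrite -formE //; apply: ideal_gen_mem; right; exists E; split=> //.
  by rewrite /sylvester_index lt1 (leq_ltn_trans (card_form_le leEC) ltCp).
exact/form_leP.
Qed.

End Sylvester.

Theorem proposition2p4 (k : fieldType) (n a b p : nat) (s : 'S_n)
    (hn : (1 <= n)%N) (hb : (0 < b)%N) (hab : (2 * b < a)%N)
    (hp : is_sylvester_degree n a b p)
    (j : nat) (hj : (2 <= j <= p.-1)%N)
    (C D : {set 'I_n}) (hC : #|C| = j)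
    (hCD : form_succ p C D) :
  (forall g : {mpoly k[1 + (n + n)]},
     colon (idealH a b p C) (formH k a b p D) g <->
     colon (in_ideal s (idealH a b p C)) (in_term s (formH k a b p D)) g)
  /\ monomial_ideal (colon (idealH (k := k) a b p C) (formH k a b p D)).
Proof.
rewrite -{}hC in hj; have [idD ltCD minD] := hCD.
have le_ba : b <= a by lia.
have cardCD : #|C| <= #|D| by case: ltCD => [/ltnW//|[->]].
have le_pn : p <= n.
  by move: hp; rewrite /is_sylvester_degree; case: ifP => _ => [/andP[/andP[]]|/eqP->].
have cardDp : #|D| <= p.
  by case/andP: idD => _ /orP[/ltnW//|/eqP->]; rewrite card_ord_lt.
have formD : formH k a b p D = binom a b k (inr D).
  have [ltDp|leDp] := ltnP #|D| p.
    by apply: formHE => //; exact: sylvester_degree_gt hp ltDp.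
  case/andP: idD => _ /orP[|/eqP->]; first by rewrite ltnNge leDp.
  exact: formH_last.
have C_ge2 : 1 < #|C| by case/andP: hj.
have D_gt0 : 0 < #|D| by apply: leq_trans cardCD; exact: ltnW.
have G_gt0 E : formset C E -> 0 < #|E| by case/andP.
have G1 i : formset C [set i].
  by rewrite /formset cards1; apply/form_leP; right; left; rewrite cards1.
have Gdown (E F : {set 'I_n}) : formset C E -> 0 < #|F| < #|E| -> formset C F.
  case/andP=> _ /card_form_le leEC /andP[F_gt0 ltFE]; rewrite /formset F_gt0.
  by apply/form_leP; right; left; exact: leq_trans ltFE leEC.
(* D is the first form beyond C, so every form of smaller degree is up to C *)
have GD (F : {set 'I_n}) : 0 < #|F| < #|D| -> formset C F.
  case/andP=> F_gt0 ltFD; rewrite /formset F_gt0 /=.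
  have [//|/form_leP /form_lt_total ltCF] := boolP (form_le F C).
  have idF : sylvester_index p F.
    apply/andP; split; last by rewrite (leq_trans ltFD cardDp).
    by case: ltCF => [ltc|[<- _]] //; apply: ltn_trans ltc.
  case: (minD F idF ltCF) => [eqF|[ltc|[eqc _]]].
  - by move: ltFD; rewrite eqF ltnn.
  - by move: ltFD; rewrite ltnNge ltnW.
  - by move: ltFD; rewrite eqc ltnn.
have leGD E : formset C E -> #|E| <= #|D|.
  by case/andP=> _ /card_form_le leEC; exact: leq_trans cardCD.
have IE := @idealH_ruleI k _ _ _ _ _ hb hab hp hj.
have cin g := @colon_next_in _ _ _ s hb le_ba _ G_gt0 G1 Gdown k D D_gt0 GD leGD g.
have [M monM] := colon_next_monomial s hb le_ba G_gt0 G1 Gdown k D_gt0 GD leGD.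
split=> [g|]; last first.
  by exists M => f; rewrite -monM /colon formD; exact: IE.
rewrite /colon formD; split=> [/IE/cin|/(in_ideal_ext s IE)/cin/IE //].
by move/(in_ideal_ext s IE).
Qed.
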